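(* Let $\{r_j\}_{j\ge1}$ be a sequence with $0<r_j<1/2$ for all $j$, and suppose $\sup_j r_j<1/2$. Then given any $\alpha$ with $0\le\alpha<\dim_L C\{r_j\}$ there is some complementary set $E$ of the gap sequence of the central Cantor set $C\{r_j\}$ such that $\dim_L E=\alpha$.
   Context: Given ratios $\{r_j\}_{j\ge1}$ with $0<r_j<1/2$, the central Cantor set $C\{r_j\}$ is constructed in the same fashion as the classical Cantor set starting from $[0,1]$ (at each step removing from each interval a centred open interval), with the $2^k$ closed intervals of step $k$ each having length $r_1\cdots r_k$. Its gap sequence is $a=\{a_i\}_{i\ge 1}$, where $a_1=1-2r_1$ and $a_i=r_1\cdots r_n(1-2r_{n+1})$ if $2^n\le i\le 2^{n+1}-1$, $n\ge1$ (not necessarily decreasing). For a positive summable sequence $a$ with sum $L$, the complementary sets of $a$ are the closed subsets $E$ of $[0,L]$ of the form $E=[0,L]\setminus\bigcup_{j=1}^\infty U_j$, where $\{U_j\}$ is a disjoint family of open intervals contained in $[0,L]$ with the length of $U_j$ equal to $a_j$ for each $j$. For non-empty $F\subset\mathbb{R}$, $N_r(F)$ denotes the minimum number of closed balls of radius $r$ needed to cover $F$, and $B(x,R)$ is the closed ball of radius $R$ centred at $x$. The Lower Assouad dimension is $$\dim_L F=\sup\Bigl\{\alpha:\ \exists\, c,\rho>0 \text{ such that } \inf_{x\in F}N_r(B(x,R)\cap F)\ge c\left(\tfrac{R}{r}\right)^{\alpha}\text{ for all }0<r<R<\rho\Bigr\}.$$ *)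

(* Defs.v *)
From HB Require Import structures.
From mathcomp Require Import all_boot all_order all_algebra.
From mathcomp Require Import all_classical all_reals all_analysis.

Set Implicit Arguments.
Unset Strict Implicit.
Unset Printing Implicit Defensive.

Import Order.TTheory GRing.Theory Num.Theory.
Import numFieldNormedType.Exports.

Local Open Scope classical_set_scope.
Local Open Scope ring_scope.

(* All sequences are indexed from 0: the value at [j] of a
   sequence [r] or [a] is the (j+1)-th term of the sequence written
   r_1, r_2, ... or a_1, a_2, ... on paper. *)

(* A pair [(x, y)] encodes the closed interval [x, y]. Step [k.+1] removes from
   each [x, y] the centred open interval of length (1 - 2 r_{k+1}) (y - x). *)
Fixpoint cantor_step (R : realType) (r : R^nat) (k : nat) : seq (R * R) :=
  if k is k'.+1 then
    flatten [seq [:: (J.1, J.1 + r k' * (J.2 - J.1));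
                     (J.2 - r k' * (J.2 - J.1), J.2)]
            | J <- cantor_step r k']
  else [:: (0, 1)].

Definition central_cantor (R : realType) (r : R^nat) : set R :=
  \bigcap_k \bigcup_(J in [set` cantor_step r k]) `[J.1, J.2]%classic.

(* With i = j + 1 >= 1, [trunc_log 2 i] is the n such that
   2^n <= i <= 2^(n+1) - 1, and a_i = r_1 ... r_n (1 - 2 r_{n+1}). *)
Definition central_gap (R : realType) (r : R^nat) : R^nat := fun j =>
  let n := trunc_log 2 j.+1 in (\prod_(i < n) r i) * (1 - 2 * r n).

(* Meant for positive summable [a], so that the series converges. *)
Definition complementary_set (R : realType) (a : R^nat) (E : set R) : Prop :=
  let L := limn (series a) in
  closed E /\
  exists U : nat -> set R,
    [/\ forall j, exists x y : R, U j = `]x, y[%classic /\ y - x = a j,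
        forall j, U j `<=` `[0, L]%classic,
        trivIset setT U &
        E = `[0, L]%classic `\` \bigcup_j U j].

(* Meant for 0 < r. The infimum is over a set of natural numbers, hence a
   minimum as soon as F has a finite cover; it is +oo otherwise. *)
Definition covering_number (R : realType) (r : R) (F : set R) : \bar R :=
  ereal_inf [set (size s)%:R%:E | s in
    [set s : seq R | F `<=` \bigcup_(c in [set` s]) closed_ball c r]].

(* Meant for nonempty [F]. *)
Definition lower_assouad_dim (R : realType) (F : set R) : \bar R :=
  ereal_sup [set alpha%:E | alpha in
    [set alpha : R | exists c rho : R, [/\ 0 < c, 0 < rho &
      forall r s : R, 0 < r -> r < s -> s < rho ->
        ((c * (s / r) `^ alpha)%:E <=
         ereal_inf [set covering_number r (closed_ball x s `&` F)
                   | x in F])%E]]].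

(* Main.v *)
Require Import Defs.
From HB Require Import structures.
From mathcomp Require Import all_boot all_order all_algebra.
From mathcomp Require Import all_classical all_reals all_analysis.
From mathcomp Require Import zify ring lra.

(** A gap sequence can be laid out from left to right in any linear order: put
    each gap at the total length of the gaps that precede it.  The set built
    here is such a layout, in two consecutive parts.

    Write [scale k] for the length [r_1 ... r_k] of the intervals of step [k].
    Covering the leftmost interval of step [k] by intervals of step [m] shows
    that [alpha] being below the dimension of the Cantor set forces
    [2 ^ (m - k) >= c * (scale k / scale m) ^ beta] for some [beta > alpha]
    ([central_cantor_growth]).  In particular the ratios [r_j] are bounded away
    from 0; they are bounded away from 1/2 by assumption, so a gap of level [k]
    is comparable to [scale k].

    The thin part is a Cantor set that uses few gaps: its tree branches at a
    level [k > 0] exactly when its number of nodes is at most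
    [scale k ^ (- alpha)].  The number of nodes never exceeds
    [2 * scale k ^ (- alpha)] ([thin_count_le]), and by the growth estimate
    the greedy rule keeps it above a constant multiple of
    [scale k ^ (- alpha)] ([thin_count_ge]).  The nodes of level [k] have
    length at most [scale k], and balls in the thin part are covered as if it
    had dimension [alpha] at every place and scale.

    The fat part is the original Cantor set in which the gaps given to the thin
    part have been closed up.  Those gaps are chosen among those of the left
    children in the binary tree, so every node keeps a gap comparable to its
    scale, in itself or in its right child.  Hence the nodes remain separated
    and the growth estimate gives lower bounds of exponent [alpha] there too.

    Both lower bounds come from one lemma on tree-like layouts
    ([covering_part_ge]), and together they give dimension at least [alpha]
    ([le_dim_arranged]).  For the upper bound one looks at a ball around the
    left end of the thin part ([dim_arranged_le]).  When [alpha] is 0 the thin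
    tree branches only once and its left end is an isolated point; the lower
    bound is then trivial, and the upper bound is the same. *)

Set Implicit Arguments.
Unset Strict Implicit.
Unset Printing Implicit Defensive.

Import Order.TTheory GRing.Theory Num.Theory.
Import numFieldNormedType.Exports.

Local Open Scope classical_set_scope.
Local Open Scope ring_scope.

(** * Sums over sets of indices *)

Section Subsum.
Variables (R : realType) (a : R^nat).
Hypotheses (a_ge0 : forall q, 0 <= a q) (cvg_a : cvgn (series a)).

Definition subsum (P : pred nat) : R :=
  limn (series (fun q => if P q then a q else 0)).

Lemma cvg_subsum (P : pred nat) :
  cvgn (series (fun q => if P q then a q else 0)).
Proof.
by apply: (series_le_cvg _ a_ge0 _ cvg_a) => q; case: ifP.
Qed.

Lemma eq_subsum (P Q : pred nat) : P =1 Q -> subsum P = subsum Q.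
Proof.
by move=> PQ; rewrite /subsum; under eq_fun do rewrite PQ.
Qed.

Lemma subsum_le_bound (P : pred nat) (B : R) :
  (forall n, exists2 m, (n <= m)%N & \sum_(0 <= q < m | P q) a q <= B) ->
  subsum P <= B.
Proof.
move=> PB; apply: limr_le; [exact: cvg_subsum|apply: nearW => n].
have [m nm mB] := PB n; apply: le_trans mB.
rewrite [leRHS]big_mkcond /series/= (big_cat_nat (leq0n n) nm)//= lerDl.
by apply: sumr_ge0 => q _; case: ifP.
Qed.

Lemma subsum_ge0 (P : pred nat) : 0 <= subsum P.
Proof.
apply: limr_ge; [exact: cvg_subsum|apply: nearW => n].
by apply: sumr_ge0 => q _; case: ifP.
Qed.

Lemma subsumU (P Q : pred nat) : (forall q, P q -> ~~ Q q) ->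
  subsum (fun q => P q || Q q) = subsum P + subsum Q.
Proof.
move=> PQ; rewrite /subsum -lim_seriesD; [|exact: cvg_subsum..].
congr (limn (series _)); apply/funext => q /=; rewrite /GRing.add/=.
have := PQ q; case: (P q) => /=; case: (Q q) => //= h; rewrite ?addr0 ?add0r//.
by move: (h isT).
Qed.

Lemma subsum0 : subsum (fun=> false) = 0.
Proof.
apply/le_anti; rewrite subsum_ge0 andbT; apply: subsum_le_bound => n.
by exists n => //; rewrite big_pred0.
Qed.

Lemma subsum1 (q : nat) : subsum (pred1 q) = a q.
Proof.
apply: cvg_lim => //; apply: cvg_near_cst; exists q.+1 => // n /= qn.
by rewrite /series/= -big_mkcond big_nat1_eq/= qn.
Qed.

Lemma subsumT : subsum xpredT = limn (series a).
Proof. by []. Qed.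

Lemma le_subsum (P Q : pred nat) :
  (forall q, P q -> Q q) -> subsum P <= subsum Q.
Proof.
move=> PQ; rewrite (@eq_subsum Q (fun q => P q || (Q q && ~~ P q))).
  by rewrite subsumU ?lerDl ?subsum_ge0// => q ->; rewrite andbF.
move=> q; case: (boolP (P q)) => /= [/PQ//|_]; first by rewrite andbT.
Qed.

Lemma le_mem_subsum (P : pred nat) (q : nat) : P q -> a q <= subsum P.
Proof.
by move=> Pq; rewrite -subsum1; apply: le_subsum => k /eqP->.
Qed.

End Subsum.

(** * Placing gaps in the order of their keys *)

Section Arrangement.
Variables (R : realType) (a : R^nat) (key : nat -> R).
Hypotheses (a_gt0 : forall q, 0 < a q) (cvg_a : cvgn (series a)).
Hypothesis (key_inj : injective key).

Let a_ge0 q : 0 <= a q. Proof. exact: ltW. Qed.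

(** [key] ranks the gaps from left to right, so the gap [q] has to start at the
    total length [below (key q)] of the gaps that precede it.  A linear order
    of the gaps thus determines a complementary set, and every statement about
    that set becomes one about sums over sets of indices. *)
Definition below (c : R) : R := subsum a (fun q => key q < c).
Definition upto (c : R) : R := subsum a (fun q => key q <= c).

Definition arranged : set R :=
  `[0, limn (series a)]%classic `\`
    \bigcup_q `]below (key q), upto (key q)[%classic.

Lemma below_le_upto (c d : R) : c <= d -> below c <= upto d.
Proof.
by move=> cd; apply: le_subsum => // q /ltW kc; exact: le_trans cd.
Qed.

Lemma upto_le_below (c d : R) : c < d -> upto c <= below d.
Proof.
by move=> cd; apply: le_subsum => // q kc; exact: le_lt_trans cd.
Qed.

Lemma upto_le (c d : R) : c <= d -> upto c <= upto d.
Proof.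
by move=> cd; apply: le_subsum => // q kc; exact: le_trans cd.
Qed.

Lemma upto_key q : upto (key q) = below (key q) + a q.
Proof.
rewrite -(subsum1 a q) /upto /below -subsumU//; last first.
  by move=> k; apply: contraTN => /eqP->; rewrite ltxx.
by apply: eq_subsum => k /=; rewrite le_eqVlt (inj_eq key_inj) orbC.
Qed.

Lemma upto_nokey (c : R) : (forall q, key q != c) -> upto c = below c.
Proof.
by move=> kc; apply: eq_subsum => q; rewrite le_eqVlt (negPf (kc q)).
Qed.

Lemma upto_sub_below (c d : R) : c < d ->
  below d - upto c = subsum a (fun q => c < key q < d).
Proof.
move=> cd; apply/eqP; rewrite subr_eq; apply/eqP.
rewrite /below /upto -subsumU//; last first.
  by move=> q /andP[ck _]; rewrite -ltNge.
apply: eq_subsum => q; case: (ltP c (key q)) => /= [_|kc]; first by rewrite orbF.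
by rewrite (le_lt_trans kc cd).
Qed.

Lemma below_ge0 c : 0 <= below c. Proof. exact: subsum_ge0. Qed.

Lemma upto_le_total c : upto c <= limn (series a).
Proof. by rewrite -subsumT; apply: le_subsum. Qed.

Lemma arranged_complementary : complementary_set a arranged.
Proof.
split.
  rewrite /arranged setDE; apply: closedI; first exact: itv_closed.
  by apply: open_closedC; apply: bigcup_open => q _; exact: itv_open.
exists (fun q => `]below (key q), upto (key q)[%classic); split => //.
- move=> q; exists (below (key q)), (upto (key q)); split=> //.
  by rewrite upto_key addrAC subrr add0r.
- move=> q x /=; rewrite !in_itv/= => /andP[xl xu]; apply/andP; split.
    by rewrite (le_trans (below_ge0 _) (ltW xl)).
  by rewrite (le_trans (ltW xu) (upto_le_total _)).
- apply/trivIsetP => i j _ _ ij; apply/seteqP; split => // x [] /=.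
  rewrite !in_itv/= => /andP[il iu] /andP[jl ju].
  have := ij; rewrite -(inj_eq key_inj) => /lt_total/orP[] /upto_le_below h.
  + by have := lt_le_trans iu (le_trans h (ltW jl)); rewrite ltxx.
  + by have := lt_le_trans ju (le_trans h (ltW il)); rewrite ltxx.
Qed.

(** A cut of the key order at any value [c] leaves each gap entirely on one
    side, hence yields a point of the set: this is the supply of points used in
    the lower bounds. *)
Lemma upto_arranged (c : R) : arranged (upto c).
Proof.
split=> [|[q _]] /=; rewrite !in_itv/=.
  by rewrite subsum_ge0//= upto_le_total.
case/andP; case: (leP (key q) c) => [kc _|kc h].
  by move/(le_lt_trans (upto_le kc)); rewrite ltxx.
by have := lt_le_trans h (upto_le_below kc); rewrite ltxx.
Qed.

End Arrangement.

(** * Covering numbers *)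

Section Covering.
Variable (R : realType).
Implicit Types (F : set R) (r : R).

Lemma closed_ballP (x y r : R) : 0 < r -> closed_ball x r y <-> `|x - y| <= r.
Proof. by move=> r0; rewrite closed_ballE. Qed.

Lemma covering_number_le F r (s : seq R) :
  F `<=` \bigcup_(c in [set` s]) closed_ball c r ->
  (covering_number r F <= (size s)%:R%:E)%E.
Proof. by move=> Fs; apply: ereal_inf_lbound; exists s. Qed.

Lemma covering_number_ge_separated F r (N : nat) (y : nat -> R) : 0 < r ->
  (forall i, (i < N)%N -> F (y i)) ->
  (forall i j, (i < j < N)%N -> 2 * r < y j - y i) ->
  (N%:R%:E <= covering_number r F)%E.
Proof.
move=> r0 Fy ysep; apply: le_ereal_inf_tmp => _ [s /= Fs <-].
rewrite lee_fin ler_nat.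
(* Distinct points lie near distinct centres, so the centres outnumber them. *)
have near_center i : (i < N)%N -> exists2 c, c \in s & `|c - y i| <= r.
  by move=> /Fy/Fs[c /= cs /(closed_ballP _ _ r0)]; exists c.
pose f i := nth 0 s (find (fun c => `|c - y i| <= r) s).
have fP i : (i < N)%N -> f i \in s /\ `|f i - y i| <= r.
  move=> /near_center[c cs ci].
  have hs : has (fun c => `|c - y i| <= r) s by apply/hasP; exists c.
  by split; [rewrite mem_nth// -has_find | exact: (nth_find 0 hs)].
rewrite -(size_iota 0 N) -(size_map f); apply: uniq_leq_size; last first.
  by move=> c /mapP[i]; rewrite mem_iota add0n => /fP[fs _] ->.
rewrite map_inj_in_uniq ?iota_uniq// => i j; rewrite !mem_iota !add0n /=.
have no_lt u v : (u < v < N)%N -> f u = f v -> False.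
  move=> uvN fuv; have /andP[uv vN] := uvN.
  have [_] := fP _ vN; have [_] := fP u (ltn_trans uv vN).
  rewrite fuv !ler_distl => /andP[h1 h2] /andP[h3 h4].
  by have := ysep u v uvN; lra.
move=> iN jN fij; case: (ltngtP i j) => // ij.
  by case: (no_lt i j); rewrite ?ij.
by case: (no_lt j i); rewrite ?ij.
Qed.

(** It suffices to check the defining inequality of the lower dimension on a
    geometric net of scales: rounding [s] down to a scale [l k] and [r] up to
    a scale [c0 * l m] changes [s / r] by a bounded factor only, as
    consecutive scales have bounded ratio.  Here [2 ^ n k] is the number of
    cells of size [l k] in a tree-like set, so that [2 ^ (n m - n k)] is the
    number of descendants at scale [l m] of one cell. *)
Lemma covering_number_ge_power (E A : set R) (l : R^nat) (n : nat -> nat)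
    (c0 c1 rmin gamma : R) :
  0 < c0 -> 0 < c1 -> 0 < rmin -> rmin <= 1 -> 0 <= gamma ->
  l 0 = 1 -> (forall k, 0 < l k) ->
  (forall k, rmin * l k <= l k.+1) ->
  {homo l : k m / (k <= m)%N >-> m <= k} ->
  (forall e, 0 < e -> exists k, l k <= e) ->
  (forall k m, (k <= m)%N -> c1 * (l k / l m) `^ gamma <= 2 ^+ (n m - n k)) ->
  (forall x k m, A x -> (k <= m)%N -> exists y : nat -> R,
    (forall i, (i < 2 ^ (n m - n k))%N -> E (y i) /\ `|x - y i| <= l k) /\
    (forall i j, (i < j < 2 ^ (n m - n k))%N -> c0 * l m <= y j - y i)) ->
  exists2 c : R, 0 < c & forall x r s, A x -> 0 < r -> r < s -> s < 1 ->
    ((c * (s / r) `^ gamma)%:E <= covering_number r (closed_ball x s `&` E))%E.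
Proof.
move=> c00 c10 rmin0 rmin1 gamma0 l0 l_gt0 l_step l_noninc l_small growth pts.
pose h := rmin ^+ 2 * c0 / 2; have h0 : 0 < h by rewrite !mulr_gt0 ?exprn_gt0.
have c1h : 0 < Num.min 1 c1 by rewrite lt_min ltr01.
exists (Num.min 1 c1 * h `^ gamma) => [|x r s Ax r0 rs s1].
  by rewrite mulr_gt0// powR_gt0.
have s0 : 0 < s := lt_trans r0 rs.
have ball_pts k m : l k <= s -> (k <= m)%N ->
    ((k < m)%N -> 2 * r < c0 * l m) ->
    ((2 ^+ (n m - n k))%:E <= covering_number r (closed_ball x s `&` E))%E.
  move=> lks km r_lm; have [y [yE ysep]] := pts x k m Ax km.
  rewrite -natrX; apply: (covering_number_ge_separated (y := y)) => // [i iN|i j ij].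
    have [Ey xy] := yE i iN; split=> //; apply/closed_ballP => //.
    exact: le_trans lks.
  apply: lt_le_trans (ysep i j ij); apply: r_lm.
  rewrite ltn_neqAle km andbT; apply/eqP => km'; move: ij.
  by rewrite km' subnn expn0; lia.
have [k lks sl] : exists2 k, l k <= s & rmin * s <= l k.
  have ex_k : exists k, l k <= s by exact: l_small.
  case: (ex_minnP ex_k) => k lks kmin; exists k => //.
  case: k lks kmin => [|k] lks kmin; first by rewrite l0 in lks; lra.
  apply: le_trans (l_step k); rewrite ler_pM2l// ltW// ltNge.
  by apply/negP => /kmin; rewrite ltnn.
(* [m0] is the first scale too fine to separate balls of radius [r]. *)
have [m0 lm0 m0min] : exists2 m, c0 * l m <= 2 * r &
    forall i, (i < m)%N -> 2 * r < c0 * l i.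
  have ex_m : exists m, c0 * l m <= 2 * r.
    have [|m lm] := l_small (2 * r / c0); first by rewrite divr_gt0// mulr_gt0.
    by exists m; rewrite mulrC -ler_pdivlMr.
  case: (ex_minnP ex_m) => m lm mmin; exists m => // i im.
  by rewrite ltNge; apply/negP => /mmin; rewrite leqNgt im.
have sr0 : 0 <= s / r by rewrite divr_ge0// ltW.
have h_sr : rmin ^+ 2 * c0 * l m0 * s <= rmin * l k * (2 * r).
  rewrite (_ : _ * s = (rmin * (rmin * s)) * (c0 * l m0)); last by ring.
  apply: ler_pM => //; first by rewrite !mulr_ge0 ?ltW.
    by rewrite mulr_ge0 ?ltW.
  by rewrite ler_pM2l.
rewrite -mulrA -powRM//; last exact: ltW.
(* If [m0 <= k], then [s / r] is bounded and a single point is enough. *)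
have [m0k|km0] := leqP m0 k.
  apply: le_trans (ball_pts k k lks (leqnn k) _); last by rewrite ltnn.
  rewrite subnn expr0 lee_fin.
  have hsr1 : h * (s / r) <= 1.
    rewrite mulrA ler_pdivrMr// mul1r /h mulrAC ler_pdivrMr//.
    have lm0k : l k <= l m0 by exact: l_noninc.
    rewrite -(ler_pM2l (l_gt0 m0)).
    apply: le_trans (_ : rmin * l k * (2 * r) <= _).
      by apply: le_trans h_sr; rewrite le_eqVlt; apply/orP; left; apply/eqP; ring.
    rewrite [r * 2]mulrC.
    rewrite ler_pM2r ?mulr_gt0//; apply: le_trans lm0k.
    by rewrite ger_pMl.
  apply: mulr_ile1; rewrite ?powR_ge0 ?ge_min ?lexx//; first exact: ltW.
  have one_pow : 1 `^ gamma = 1 :> R by rewrite powR1.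
  rewrite -[leRHS]one_pow; apply: ge0_ler_powR => //; rewrite nnegrE//.
  by rewrite mulr_ge0// ltW.
case: m0 => [//|m] in lm0 m0min h_sr km0 *.
apply: le_trans (ball_pts k m lks km0 (fun _ => m0min m (ltnSn m))).
rewrite lee_fin; apply: le_trans (growth k m km0).
apply: ler_pM; rewrite ?powR_ge0 ?ge_min ?lexx ?orbT//; first exact: ltW.
apply: ge0_ler_powR => //.
- by rewrite nnegrE mulr_ge0// ltW.
- by rewrite nnegrE divr_ge0// ltW.
rewrite ler_pdivlMr//.
rewrite (_ : _ * l m = rmin ^+ 2 * c0 * s / 2 * l m / r); last first.
  by rewrite /h; field; rewrite gt_eqF.
rewrite ler_pdivrMr// -(ler_pM2l rmin0) mulrCA.
apply: le_trans (_ : rmin ^+ 2 * c0 * s / 2 * l m.+1 <= _).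
  by rewrite ler_pM2l// !mulr_gt0 ?exprn_gt0.
by move: h_sr; lra.
Qed.

End Covering.

(** * The gaps of a central Cantor set, level by level *)

(** The index [q] (counted from 0) is the gap of rank [rank q] among the
    [2 ^ level q] gaps of its level, which have indices from [2 ^ j - 1] to
    [2 ^ j.+1 - 2] for [j = level q]. *)
Definition level (q : nat) : nat := trunc_log 2 q.+1.
Definition rank (q : nat) : nat := (q.+1 - 2 ^ level q)%N.
Definition gap_index (j p : nat) : nat := (2 ^ j + p).-1.

Lemma gap_indexK j p : (p < 2 ^ j)%N ->
  level (gap_index j p) = j /\ rank (gap_index j p) = p.
Proof.
move=> pj; have j0 : (0 < 2 ^ j)%N by rewrite expn_gt0.
have idxS : (gap_index j p).+1 = (2 ^ j + p)%N.
  by rewrite /gap_index prednK// addn_gt0 j0.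
have lev : level (gap_index j p) = j.
  by rewrite /level idxS; apply: trunc_log_eq => //; rewrite expnS; lia.
by split=> //; rewrite /rank lev idxS addKn.
Qed.

Lemma levelP q : (2 ^ level q <= q.+1 < 2 ^ (level q).+1)%N.
Proof. exact: trunc_log_bounds. Qed.

Lemma rank_lt q : (rank q < 2 ^ level q)%N.
Proof. by have := levelP q; rewrite /rank expnS; lia. Qed.

Lemma level_rank_inj q q' : level q = level q' -> rank q = rank q' -> q = q'.
Proof.
move=> lq; rewrite /rank lq => rq.
by have := levelP q; have := levelP q'; rewrite lq; lia.
Qed.

Lemma level_eq q j : (2 ^ j <= q.+1 < 2 ^ j.+1)%N -> level q = j.
Proof. exact: trunc_log_eq. Qed.

Section CentralGap.
Variables (R : realType) (r : R^nat).
Hypothesis r_bounds : forall j, 0 < r j < 2^-1.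

Definition scale (k : nat) : R := \prod_(i < k) r i.

Lemma scale0 : scale 0 = 1. Proof. by rewrite /scale big_ord0. Qed.

Lemma scaleS k : scale k.+1 = scale k * r k.
Proof. by rewrite /scale big_ord_recr. Qed.

Lemma scale_gt0 k : 0 < scale k.
Proof. by apply: prodr_gt0 => i _; case/andP: (r_bounds i). Qed.

Lemma scaleS_lt k : scale k.+1 < scale k / 2.
Proof. by rewrite scaleS ltr_pM2l ?scale_gt0//; case/andP: (r_bounds k). Qed.

Lemma scale_noninc : {homo scale : k m / (k <= m)%N >-> m <= k}.
Proof.
apply: homo_leq => [//|x y z h1 h2|k]; first exact: le_trans h1.
by have := scaleS_lt k; have := scale_gt0 k; lra.
Qed.

Lemma scale_le_half k : scale k <= 2^-1 ^+ k.
Proof.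
elim: k => [|k ih]; first by rewrite scale0 expr0.
by rewrite exprSr; have := scaleS_lt k; lra.
Qed.

Lemma scale_le1 k : scale k <= 1.
Proof. by rewrite -scale0 scale_noninc. Qed.

Lemma scale_small (e : R) : 0 < e -> exists k, scale k <= e.
Proof.
move=> e0; have := @cvg_expr R 2^-1; rewrite ger0_norm// invf_lt1 ?ltr1n// => /(_ isT).
move=> /cvgrPdist_lt/(_ _ e0)[k _ /(_ k (leqnn k))].
rewrite sub0r normrN ger0_norm ?exprn_ge0// => /ltW ke.
by exists k; apply: le_trans ke; exact: scale_le_half.
Qed.

Lemma central_gapE q :
  central_gap r q = scale (level q) * (1 - 2 * r (level q)).
Proof. by []. Qed.

Lemma central_gap_gt0 q : 0 < central_gap r q.
Proof.
rewrite central_gapE mulr_gt0 ?scale_gt0//.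
by have /andP[] := r_bounds (level q); lra.
Qed.

(** The bound telescopes: an interval of length [scale k] consists of its gaps
    of levels [k], ..., [k + N - 1] and of [2 ^ N] intervals of length
    [scale (k + N)], and [P] has at most as many gaps per level. *)
Lemma partial_sum_le_scale (P : pred nat) k N :
  (forall q, P q -> (k <= level q)%N) ->
  (forall j, (k <= j)%N ->
    (count P (index_iota (2 ^ j).-1 (2 ^ j.+1).-1) <= 2 ^ (j - k))%N) ->
  \sum_(0 <= q < (2 ^ (k + N)).-1 | P q) central_gap r q
    <= scale k - 2 ^+ N * scale (k + N).
Proof.
move=> Pk Pcount; elim: N => [|N ih].
  rewrite addn0 expr0 mul1r subrr big_nat_cond big_pred0// => q.
  apply/negP => /andP[/andP[_ qk] /Pk kq]; have := levelP q.
  by have := leq_pexp2l (isT : (0 < 2)%N) kq; lia.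
have mono : ((2 ^ (k + N)).-1 <= (2 ^ (k + N).+1).-1)%N by rewrite expnS; lia.
rewrite addnS (big_cat_nat (leq0n _) mono) /=.
set S := (X in _ + X <= _).
have SE : S <= 2 ^+ N * (scale (k + N) * (1 - 2 * r (k + N))).
  rewrite /S big_nat_cond.
  rewrite (eq_bigr (fun=> scale (k + N) * (1 - 2 * r (k + N)))); last first.
    move=> q /andP[/andP[q1 q2] _]; rewrite central_gapE.
    rewrite (@level_eq q (k + N))//; have : (0 < 2 ^ (k + N))%N by rewrite expn_gt0.
    by move: q1 q2; rewrite expnS; lia.
  rewrite -big_nat_cond big_const_seq iter_addr_0 -[leLHS]mulr_natl.
  apply: ler_wpM2r; last first.
    by rewrite -natrX ler_nat (leq_trans (Pcount _ (leq_addr _ _)))// addKn.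
  rewrite mulr_ge0 ?(ltW (scale_gt0 _))//.
  by have /andP[] := r_bounds (k + N); lra.
have lS := scaleS (k + N).
apply: le_trans (lerD ih SE) _.
rewrite lS exprS le_eqVlt; apply/orP; left; apply/eqP; ring.
Qed.

Lemma subsum_le_scale (P : pred nat) k :
  (forall q, P q -> (k <= level q)%N) ->
  (forall j, (k <= j)%N ->
    (count P (index_iota (2 ^ j).-1 (2 ^ j.+1).-1) <= 2 ^ (j - k))%N) ->
  cvgn (series (central_gap r)) ->
  subsum (central_gap r) P <= scale k.
Proof.
move=> Pk Pcount cvg; apply: subsum_le_bound => //.
  by move=> q; exact/ltW/central_gap_gt0.
move=> n; exists (2 ^ (k + n)).-1.
  by have := ltn_expl (k + n) (isT : (1 < 2)%N); lia.
apply: le_trans (partial_sum_le_scale n Pk Pcount) _.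
by rewrite gerBl mulr_ge0 ?exprn_ge0// ltW// scale_gt0.
Qed.

Lemma cvg_central_gap : cvgn (series (central_gap r)).
Proof.
apply: nondecreasing_is_cvgn.
  by apply: nondecreasing_series => n _ _; exact/ltW/central_gap_gt0.
exists 1 => _ [n _ <-].
have nN : (n <= (2 ^ (0 + n)).-1)%N.
  by have := ltn_expl n (isT : (1 < 2)%N); rewrite add0n; lia.
have := @partial_sum_le_scale xpredT 0 n (fun=> fun=> isT).
rewrite scale0 => h; apply: le_trans (_ : _ <= 1 - 2 ^+ n * scale (0 + n)) _; last first.
  by rewrite gerBl mulr_ge0 ?exprn_ge0// ltW// scale_gt0.
apply: le_trans (h _) => [|j _].
  rewrite /series/= (big_cat_nat (leq0n n) nN)//= lerDl.
  by apply: sumr_ge0 => q _; exact/ltW/central_gap_gt0.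
by rewrite count_predT size_iota subn0 expnS; lia.
Qed.

End CentralGap.

(** * Dyadic numbers *)

Definition dyadic (R : realType) (n p : nat) : R := p%:R / 2 ^+ n.

Section Dyadic.
Variable R : realType.
Local Notation dyadic := (dyadic R).

Lemma dyadic_lt n p m q : (dyadic n p < dyadic m q) = (p * 2 ^ m < q * 2 ^ n)%N.
Proof.
rewrite /dyadic ltr_pdivrMr ?exprn_gt0// mulrAC ltr_pdivlMr ?exprn_gt0//.
by rewrite -!natrX -!natrM ltr_nat.
Qed.

Lemma dyadic_le n p m q : (dyadic n p <= dyadic m q) = (p * 2 ^ m <= q * 2 ^ n)%N.
Proof. by rewrite leNgt dyadic_lt -leqNgt. Qed.

Lemma dyadic_eq n p m q : (dyadic n p == dyadic m q) = (p * 2 ^ m == q * 2 ^ n)%N.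
Proof. by rewrite eq_le !dyadic_le eqn_leq. Qed.

Lemma dyadic0 n : dyadic n 0 = 0. Proof. exact: mul0r. Qed.

Lemma dyadic_full n : dyadic n (2 ^ n) = 1.
Proof. by rewrite /dyadic natrX divff// expf_neq0// pnatr_eq0. Qed.

Lemma dyadic_odd_gt0 n s : 0 < dyadic n.+1 (2 * s + 1).
Proof. by rewrite -(dyadic0 0) dyadic_lt; have := expn_gt0 2 n; lia. Qed.

Lemma dyadic_odd_lt1 n s : (s < 2 ^ n)%N -> dyadic n.+1 (2 * s + 1) < 1.
Proof. by rewrite -(dyadic_full 0) dyadic_lt expnS; lia. Qed.

(** The midpoint of a dyadic interval of depth [m] can lie inside one of depth
    [n] only if the former interval is contained in the latter. *)
Lemma dyadic_odd_node n p m s :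
  dyadic n p < dyadic m.+1 (2 * s + 1) < dyadic n p.+1 ->
  (n <= m)%N /\ (p * 2 ^ (m - n) <= s < p.+1 * 2 ^ (m - n))%N.
Proof.
rewrite !dyadic_lt; case: (leqP n m) => [/subnKC <-|/subnKC <-].
  rewrite addKn expnS expnD => /andP[h1 h2]; split=> //.
  have n0 : (0 < 2 ^ n)%N by rewrite expn_gt0.
  have {}h1 : (p * 2 ^ (m - n) * 2 < 2 * s + 1)%N.
    by rewrite -(ltn_pmul2r n0); apply: leq_trans h1; rewrite ltnS; lia.
  have {}h2 : (2 * s + 1 < p.+1 * 2 ^ (m - n) * 2)%N.
    by rewrite -(ltn_pmul2r n0); apply: leq_trans h2 _; lia.
  by apply/andP; lia.
have m0 : (0 < 2 ^ m.+1)%N by rewrite expn_gt0.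
rewrite expnD => /andP[h1 h2].
have {}h1 : (p < (2 * s + 1) * 2 ^ (n - m.+1))%N.
  by rewrite -(ltn_pmul2r m0); apply: leq_trans h1 _; lia.
have {}h2 : ((2 * s + 1) * 2 ^ (n - m.+1) < p.+1)%N.
  by rewrite -(ltn_pmul2r m0); apply: leq_trans h2; rewrite ltnS; lia.
by lia.
Qed.

Lemma dyadic_odd_inj n s n' s' :
  dyadic n.+1 (2 * s + 1) = dyadic n'.+1 (2 * s' + 1) -> n = n' /\ s = s'.
Proof.
have odd_ne i j u v : (i < j)%N ->
    dyadic i.+1 (2 * u + 1) = dyadic j.+1 (2 * v + 1) -> False.
  move=> /subnKC <- /eqP; rewrite dyadic_eq -addnS expnD.
  rewrite mulnCA mulnC eqn_pmul2r ?expn_gt0// expnS => /eqP h.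
  by move: h; lia.
case: (ltngtP n n') => [/odd_ne h /h //|/odd_ne h /esym/h //| -> /eqP].
by rewrite dyadic_eq eqn_pmul2r ?expn_gt0// => /eqP h; split=> //; lia.
Qed.

End Dyadic.

(** * Tree-like parts of an arrangement *)

(** A part is a set of gaps whose keys fill the unit interval starting at [b]
    like the nodes of a binary tree.  At level [j] the tree has [2 ^ depth j]
    nodes; either every node has two children, separated by a gap of level [j]
    whose key is the midpoint of the node, or every node has one child.  Some
    gaps may be missing, in which case two siblings touch. *)
Section TreePart.
Variables (R : realType) (r : R^nat).
Hypothesis r_bounds : forall j, 0 < r j < 2^-1.
Variable key : nat -> R.
Variables (b : R) (depth : nat -> nat) (part : pred nat) (pos : nat -> nat).
Hypothesis depth_step : forall j, (depth j <= depth j.+1 <= (depth j).+1)%N.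
Hypothesis part_branches : forall q, part q ->
  (depth (level q) < depth (level q).+1)%N.
Hypothesis pos_inj : forall q q', part q -> part q' -> level q = level q' ->
  pos q = pos q' -> q = q'.
Hypothesis key_part : forall q, part q ->
  key q = b + dyadic R (depth (level q)).+1 (2 * pos q + 1).
Hypothesis key_nonpart : forall q, ~~ part q -> key q <= b \/ b + 1 <= key q.

Local Notation a := (central_gap r).
Local Notation upto := (upto a key).
Local Notation below := (below a key).
Local Notation E := (arranged a key).

Let a_gt0 := central_gap_gt0 r_bounds.
Let a_ge0 q : 0 <= a q. Proof. exact/ltW/a_gt0. Qed.
Let a_cvg := cvg_central_gap r_bounds.

Definition node_start (k p : nat) : R := b + dyadic R (depth k) p.
Definition node_left (k p : nat) : R := upto (node_start k p).
Definition node_right (k p : nat) : R := below (node_start k p.+1).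

Lemma depth_le k m : (k <= m)%N -> (depth k <= depth m)%N.
Proof.
move=> /subnKC <-; elim: (m - k)%N => [|e ih]; first by rewrite addn0.
by rewrite addnS; have /andP[] := depth_step (k + e); lia.
Qed.

Lemma depth_lip k m : (k <= m)%N -> (depth m - depth k <= m - k)%N.
Proof.
move=> km; rewrite -(subnKC km); elim: (m - k)%N => [|e ih]; first by rewrite addn0 subnn.
by rewrite addnS; have /andP[] := depth_step (k + e); lia.
Qed.

Lemma node_start_lt k p m q :
  (node_start k p < node_start m q) = (p * 2 ^ depth m < q * 2 ^ depth k)%N.
Proof. by rewrite ltrD2l dyadic_lt. Qed.

Lemma node_start_le k p m q :
  (node_start k p <= node_start m q) = (p * 2 ^ depth m <= q * 2 ^ depth k)%N.
Proof. by rewrite lerD2l dyadic_le. Qed.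

Lemma node_startS k p : node_start k p < node_start k p.+1.
Proof. by rewrite node_start_lt ltn_pmul2r ?expn_gt0. Qed.

Lemma node_start0 k : node_start k 0 = b.
Proof. by rewrite /node_start dyadic0 addr0. Qed.

Lemma node_start_last k : node_start k (2 ^ depth k) = b + 1.
Proof. by rewrite /node_start dyadic_full. Qed.

Lemma node_mem k p q : (p < 2 ^ depth k)%N ->
  node_start k p < key q < node_start k p.+1 ->
  [/\ part q, (k <= level q)%N &
      (p * 2 ^ (depth (level q) - depth k) <= pos q
         < p.+1 * 2 ^ (depth (level q) - depth k))%N].
Proof.
move=> pk /andP[pq qp].
have part_q : part q.
  have bp : b <= node_start k p by rewrite -(node_start0 k) node_start_le.
  have pb : node_start k p.+1 <= b + 1.
    by rewrite -(node_start_last k) node_start_le leq_pmul2r ?expn_gt0.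
  by apply/negPn/negP => /key_nonpart[]; move: bp pb pq qp; lra.
move: pq qp; rewrite key_part// !ltrD2l => pq qp.
have [kq posq] := @dyadic_odd_node R (depth k) p (depth (level q)) (pos q)
  (introT andP (conj pq qp)).
split=> //; rewrite leqNgt; apply/negP => /depth_le.
by have := part_branches part_q; lia.
Qed.

(** As the depth grows by at most one per level, a node of level [k] has no more
    gaps of each level than an interval of step [k] of the Cantor set, and is
    therefore no longer. *)
Lemma node_length k p : (p < 2 ^ depth k)%N ->
  node_right k p - node_left k p <= scale r k.
Proof.
move=> pk; rewrite upto_sub_below ?node_startS//.
apply: subsum_le_scale => // [q /(node_mem pk)[]//|j kj].
have jS : ((2 ^ j).-1 <= (2 ^ j.+1).-1)%N by rewrite expnS; lia.
have lev_j q : q \in index_iota (2 ^ j).-1 (2 ^ j.+1).-1 -> level q = j.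
  rewrite mem_index_iota => q_j; apply: level_eq.
  by have := expn_gt0 2 j; move: q_j; rewrite expnS; lia.
rewrite -size_filter -(size_map pos).
set d := (depth j - depth k)%N.
apply: leq_trans (_ : size (index_iota (p * 2 ^ d) (p.+1 * 2 ^ d)) <= _)%N; last first.
  by rewrite size_iota -mulnBl subSnn mul1n leq_pexp2l// depth_lip.
apply: uniq_leq_size => [|s /mapP[q]].
  rewrite map_inj_in_uniq ?filter_uniq ?iota_uniq// => q q'.
  rewrite !mem_filter => /andP[/(node_mem pk)[qM _ _] /lev_j qj].
  move=> /andP[/(node_mem pk)[q'M _ _] /lev_j q'j].
  by apply: pos_inj => //; rewrite qj.
rewrite mem_filter => /andP[/(node_mem pk)[qM _ qs] /lev_j qj] ->.
by rewrite mem_index_iota; move: qs; rewrite qj.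
Qed.

(** Between two consecutive nodes there is at most a gap, which [E] avoids. *)
Lemma node_cover x k : E x -> upto b <= x <= below (b + 1) ->
  exists2 p, (p < 2 ^ depth k)%N & node_left k p <= x <= node_right k p.
Proof.
move=> Ex /andP[bx xb].
have ex_p : exists p, x <= node_right k p.
  by exists (2 ^ depth k).-1; rewrite /node_right prednK ?expn_gt0// node_start_last.
case: (ex_minnP ex_p) => p xp pmin.
have pk : (p < 2 ^ depth k)%N.
  rewrite -(prednK (expn_gt0 2 (depth k))) ltnS; apply: pmin.
  by rewrite /node_right prednK ?expn_gt0// node_start_last.
exists p => //; rewrite xp andbT; case: p => [|p] in xp pmin pk *.
  by rewrite /node_left node_start0.
have px : node_right k p < x by rewrite ltNge; apply/negP => /pmin; rewrite ltnn.
rewrite /node_left leNgt; apply/negP => xp1.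
have [[q qE]|noq] := pselect (exists q, key q = node_start k p.+1); last first.
  move: px xp1; rewrite /node_right upto_nokey => [/lt_trans h/h|q].
    by rewrite ltxx.
  by apply/negP => /eqP qE; apply: noq; exists q.
have [_] := Ex; apply; exists q => //=.
by rewrite in_itv/= qE px.
Qed.

Lemma node_left_E k p : E (node_left k p).
Proof. exact: upto_arranged. Qed.

Lemma covering_part (F : set R) m :
  (forall x, F x -> E x /\ upto b <= x <= below (b + 1)) ->
  (covering_number (scale r m) F <= (2 ^+ depth m)%:E)%E.
Proof.
move=> FE; rewrite -natrX -[in leRHS](size_iota 0 (2 ^ depth m)).
rewrite -(size_map (node_left m)); apply: covering_number_le => x /FE[Ex xb].
have [p pm /andP[px xp]] := node_cover m Ex xb.
exists (node_left m p); first by apply: map_f; rewrite mem_iota.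
apply/closed_ballP; first exact: scale_gt0.
by have := node_length pm; rewrite ler_norml => len; apply/andP; split; lra.
Qed.

(** When every node contains a gap comparable to its scale, the left ends of
    the nodes are separated, and counting descendants bounds covering numbers
    from below. *)
Section Rich.
Variables (c0 : R).
Hypothesis rich : forall k p, (p < 2 ^ depth k)%N ->
  exists2 q, c0 * scale r k <= a q & node_start k p < key q < node_start k p.+1.

Lemma node_left_separated m i j : (i < j < (2 ^ depth m).+1)%N ->
  c0 * scale r m <= node_left m j - node_left m i.
Proof.
move=> ijm; have im : (i < 2 ^ depth m)%N by lia.
have [q aq qi] := rich im.
apply: le_trans aq _; apply: le_trans (_ : node_right m i - node_left m i <= _).
  rewrite upto_sub_below ?node_startS//.
  pose P q := node_start m i < key q < node_start m i.+1.
  exact: (le_mem_subsum a_ge0 a_cvg (P := P)).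
rewrite lerD2r; apply: below_le_upto => //.
by rewrite node_start_le leq_pmul2r ?expn_gt0//; lia.
Qed.

Lemma part_scattered x k m : E x -> upto b <= x <= below (b + 1) ->
  (k <= m)%N -> exists y : nat -> R,
    (forall i, (i < 2 ^ (depth m - depth k))%N ->
      E (y i) /\ `|x - y i| <= scale r k) /\
    (forall i j, (i < j < 2 ^ (depth m - depth k))%N ->
      c0 * scale r m <= y j - y i).
Proof.
move=> Ex xb km; have [p pk /andP[px xp]] := node_cover k Ex xb.
set d := (depth m - depth k)%N.
have dE : depth m = (depth k + d)%N by rewrite subnKC ?depth_le.
have pd i : (i < 2 ^ d)%N -> (p * 2 ^ d + i < 2 ^ depth m)%N.
  move=> id; apply: leq_trans (_ : p.+1 * 2 ^ d <= _)%N; first by rewrite mulSn; lia.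
  by rewrite dE expnD leq_pmul2r// expn_gt0.
exists (fun i => node_left m (p * 2 ^ d + i)); split=> [i id|i j /andP[ij jd]].
  split; first exact: node_left_E.
  have left_i : node_left k p <= node_left m (p * 2 ^ d + i).
    by apply: upto_le => //; rewrite node_start_le dE expnD; lia.
  have right_i : node_left m (p * 2 ^ d + i) <= node_right k p.
    by apply: upto_le_below => //; rewrite node_start_lt dE expnD; nia.
  have := node_length pk; rewrite ler_norml => len.
  by apply/andP; split; lra.
by apply: node_left_separated; have := pd j jd; lia.
Qed.

Lemma covering_part_ge (c1 rmin gamma : R) :
  0 < c0 -> 0 < c1 -> 0 < rmin -> rmin <= 1 -> 0 <= gamma ->
  (forall k, rmin * scale r k <= scale r k.+1) ->
  (forall k m, (k <= m)%N ->
    c1 * (scale r k / scale r m) `^ gamma <= 2 ^+ (depth m - depth k)) ->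
  exists2 c : R, 0 < c & forall x u s, E x -> upto b <= x <= below (b + 1) ->
    0 < u -> u < s -> s < 1 ->
    ((c * (s / u) `^ gamma)%:E <= covering_number u (closed_ball x s `&` E))%E.
Proof.
move=> c0_gt0 c1_gt0 rmin_gt0 rmin_le1 gamma_ge0 step growth.
have [c c_gt0 bound] := covering_number_ge_power
  (A := [set x | E x /\ upto b <= x <= below (b + 1)])
  c0_gt0 c1_gt0 rmin_gt0 rmin_le1 gamma_ge0 (scale0 r) (scale_gt0 r_bounds) step
  (scale_noninc r_bounds) (scale_small r_bounds) growth
  (fun x k m Ax => part_scattered Ax.1 Ax.2).
by exists c => // x u s Ex xb; apply: bound.
Qed.

End Rich.

End TreePart.

(** * Growth forced by the lower Assouad dimension of the central Cantor set *)

Lemma powR_le_base (R : realType) (x y e : R) :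
  0 <= e -> 0 <= x -> x <= y -> x `^ e <= y `^ e.
Proof.
by move=> e0 x0 xy; apply: ge0_ler_powR; rewrite ?nnegrE// (le_trans x0).
Qed.

Lemma powR_le1 (R : realType) (x e : R) :
  0 <= e -> 0 <= x -> x <= 1 -> x `^ e <= 1.
Proof. by move=> e0 x0 /(powR_le_base e0 x0); rewrite powR1. Qed.

Section CantorGrowth.
Variables (R : realType) (r : R^nat).
Hypothesis r_bounds : forall j, 0 < r j < 2^-1.
Local Notation scale := (scale r).

Definition split_interval (t : R) (J : R * R) : seq (R * R) :=
  [:: (J.1, J.1 + t * (J.2 - J.1)); (J.2 - t * (J.2 - J.1), J.2)].

Lemma cantor_stepS k :
  cantor_step r k.+1 = flatten [seq split_interval (r k) J | J <- cantor_step r k].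
Proof. by []. Qed.

Lemma cantor_step_length k J : J \in cantor_step r k -> J.2 - J.1 = scale k.
Proof.
elim: k J => [|k ih] J; first by rewrite inE => /eqP->; rewrite subr0 scale0.
rewrite cantor_stepS => /flatten_mapP[I /ih IE]; rewrite !inE scaleS -IE.
by case/orP => /eqP-> /=; ring.
Qed.

Lemma split_interval_left (t : R) (I J : R * R) : 0 < t < 2^-1 ->
  I.1 <= I.2 -> J \in split_interval t I -> I.1 <= J.1.
Proof. by move=> /andP[t0 t1] I12; rewrite !inE => /orP[]/eqP-> //=; nra. Qed.

(** The first [2 ^ n] intervals of step [k + n] are those contained in the
    leftmost interval [[0, scale k]] of step [k]; all others lie to its right. *)
Lemma cantor_step_descendants k n : exists s1 s2 : seq (R * R),
  [/\ cantor_step r (k + n) = s1 ++ s2, size s1 = (2 ^ n)%N &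
      forall J, J \in s2 -> scale k < J.1].
Proof.
elim: n => [|n [s1 [s2 [stepE sz_s1 s2k]]]].
  suff [s [-> sk]] : exists s, cantor_step r (k + 0) = (0, scale k) :: s /\
      forall J, J \in s -> scale k < J.1 by exists [:: (0, scale k)], s.
  rewrite addn0; elim: k => [|k [s [stepE sk]]].
    by exists [::]; split=> //=; rewrite scale0.
  exists ((scale k - r k * (scale k - 0), scale k) ::
    flatten [seq split_interval (r k) J | J <- s]); split.
    by rewrite cantor_stepS stepE /= add0r subr0 scaleS mulrC.
  move=> J; rewrite inE => /orP[/eqP->|/flatten_mapP[I Is JI]] /=.
    have := scaleS_lt r_bounds k; rewrite [in X in X -> _]scaleS scaleS subr0; lra.
  have : I \in cantor_step r k by rewrite stepE inE Is orbT.
  move=> /cantor_step_length len; have /andP[r0 r1] := r_bounds k.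
  have sg := scale_gt0 r_bounds k; have := scaleS_lt r_bounds k.
  have := split_interval_left (r_bounds k) _ JI; have := sk I Is; lra.
exists (flatten [seq split_interval (r (k + n)) J | J <- s1]).
exists (flatten [seq split_interval (r (k + n)) J | J <- s2]); split.
- by rewrite addnS cantor_stepS stepE map_cat flatten_cat.
- rewrite size_flatten /shape -map_comp (eq_map (g := fun=> 2%N))//.
  by rewrite expnSr -sz_s1; elim: (s1) => //= J s ->; lia.
- move=> J /flatten_mapP[I Is JI].
  have : I \in cantor_step r (k + n) by rewrite stepE mem_cat Is orbT.
  move=> /cantor_step_length len; have sg := scale_gt0 r_bounds (k + n).
  have := split_interval_left (r_bounds _) _ JI; have := s2k I Is; lra.
Qed.

Lemma central_cantor0 : central_cantor r 0.
Proof.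
move=> k _; exists (0, scale k); last first.
  by rewrite /= in_itv/= lexx ltW// scale_gt0.
elim: k => [|k ih]; first by rewrite /= inE scale0.
apply/flatten_mapP; exists (0, scale k) => //=.
by rewrite inE add0r subr0 scaleS mulrC eqxx.
Qed.

Lemma covering_central_cantor k n :
  (covering_number (scale (k + n))
     (closed_ball (0 : R)%R (scale k) `&` central_cantor r) <= (2 ^+ n)%:E)%E.
Proof.
have [s1 [s2 [stepE sz s2k]]] := cantor_step_descendants k n.
rewrite -natrX -sz -(size_map fst); apply: covering_number_le => x [].
move=> /(closed_ballP _ _ (scale_gt0 r_bounds k)).
rewrite sub0r normrN => xk /(_ (k + n)%N I)[J /= Jstep].
rewrite in_itv/= => /andP[J1x xJ2].
have Js1 : J \in s1.
  have := Jstep; rewrite stepE mem_cat => /orP[//|/s2k kJ].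
  by have := ler_norm x; lra.
exists J.1; first exact: map_f.
apply/closed_ballP; first exact: scale_gt0.
have := cantor_step_length Jstep; rewrite ler_norml => len.
by apply/andP; split; lra.
Qed.

(** The ball of centre 0 and radius [scale k] meets the Cantor set in the
    leftmost interval of step [k], which [2 ^ (m - k)] balls of radius
    [scale m] cover; a lower bound on covering numbers is thus a lower bound on
    the ratios.  The finitely many steps with [scale k >= rho] only affect the
    constant. *)
Lemma central_cantor_growth (beta : R) : 0 <= beta ->
  (exists c rho : R, [/\ 0 < c, 0 < rho &
      forall u s : R, 0 < u -> u < s -> s < rho ->
        ((c * (s / u) `^ beta)%:E <=
         ereal_inf [set covering_number u (closed_ball x s `&` central_cantor r)
                   | x in central_cantor r])%E]) ->
  exists2 c : R, 0 < c & forall k m, (k <= m)%N ->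
    c * (scale k / scale m) `^ beta <= 2 ^+ (m - k).
Proof.
move=> beta0 [c [rho [c0 rho0 dimC]]].
have [k0 k0_rho] : exists k, scale k < rho.
  have [|k kr] := scale_small r_bounds (_ : 0 < rho / 2); first by rewrite divr_gt0.
  by exists k; apply: le_lt_trans kr _; lra.
have c1_gt0 : 0 < Num.min 1 c by rewrite lt_min ltr01.
have tail k m : (k0 <= k <= m)%N ->
    Num.min 1 c * (scale k / scale m) `^ beta <= 2 ^+ (m - k).
  case/andP=> k0k; rewrite leq_eqVlt => /predU1P[->|km].
    by rewrite subnn expr0 divff ?powR1 ?mulr1 ?ge_min ?lexx// gt_eqF// scale_gt0.
  have mk : scale m < scale k.
    apply: le_lt_trans (scale_noninc r_bounds km) _.
    by have := scaleS_lt r_bounds k; have := scale_gt0 r_bounds k; lra.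
  have := dimC _ _ (scale_gt0 r_bounds m) mk
     (le_lt_trans (scale_noninc r_bounds k0k) k0_rho).
  move=> /le_trans/(_ (ereal_inf_lbound _)) h.
  have := h _ (ex_intro2 _ _ 0 central_cantor0 erefl).
  have := covering_central_cantor k (m - k); rewrite subnKC ?(ltnW km)//.
  move=> cov /le_trans/(_ cov); rewrite lee_fin; apply: le_trans.
  by rewrite ler_wpM2r ?powR_ge0// ge_min lexx orbT.
exists (Num.min 1 c * scale k0 `^ beta) => [|k m km].
  by rewrite mulr_gt0// powR_gt0// scale_gt0.
have [k0k|kk0] := leqP k0 k.
  apply: le_trans (tail k m _); last by rewrite k0k.
  rewrite -mulrA ler_pM2l// ler_piMl ?powR_ge0//.
  by apply: powR_le1 => //; rewrite ?scale_le1// ltW// scale_gt0.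
have [lk lm l0] := And3 (scale_gt0 r_bounds k) (scale_gt0 r_bounds m)
  (scale_gt0 r_bounds k0).
have lkm : 0 <= scale k / scale m by rewrite divr_ge0// ltW.
rewrite -mulrA -powRM//; last exact: ltW.
have [k0m|mk0] := leqP k0 m.
  apply: le_trans (_ : 2 ^+ (m - k0) <= _); last first.
    by rewrite ler_weXn2l ?ler1n// leq_sub2l// ltnW.
  apply: le_trans (tail k0 m _); last by rewrite leqnn.
  rewrite ler_pM2l//; apply: powR_le_base => //; first by rewrite mulr_ge0// ltW.
  by rewrite mulrCA ger_pMl ?divr_gt0// scale_le1.
apply: le_trans (_ : 1 <= _); last by rewrite exprn_ege1// ler1n.
apply: mulr_ile1; rewrite ?powR_ge0 ?ge_min ?lexx//; first exact: ltW.
apply: powR_le1 => //; first by rewrite mulr_ge0// ltW.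
rewrite mulrA ler_pdivrMr// mul1r.
by apply: le_trans (scale_noninc r_bounds (ltnW mk0)); rewrite ger_pMr// scale_le1.
Qed.
End CantorGrowth.

(** * Choosing the gaps of the thin part *)

Section Thin.
Variables (R : realType) (r : R^nat) (alpha : R).
Local Notation scale := (scale r).

(** A greedy choice of levels: the tree of the thin part branches at the level
    [i] as long as its number of nodes does not exceed
    [scale i `^ (- alpha)].  The level 0 is left out so that the
    tree has at most half as many nodes as there are gaps at a level where it
    branches. *)
Fixpoint thin_depth (j : nat) : nat :=
  if j is i.+1 then
    (thin_depth i + ((0 < i) && (2 ^+ thin_depth i * scale i `^ alpha <= 1)%R))%N
  else 0%N.

Definition chosen (j : nat) : bool :=
  (0 < j)%N && (2 ^+ thin_depth j * scale j `^ alpha <= 1).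

Lemma thin_depthS j : thin_depth j.+1 = (thin_depth j + chosen j)%N.
Proof. by []. Qed.

Lemma thin_depth_step j : (thin_depth j <= thin_depth j.+1 <= (thin_depth j).+1)%N.
Proof. by rewrite thin_depthS; case: (chosen j); lia. Qed.

Lemma thin_depth_chosen j : chosen j -> thin_depth j.+1 = (thin_depth j).+1.
Proof. by rewrite thin_depthS => ->; rewrite addn1. Qed.

Lemma thin_depth_lt j : chosen j -> (thin_depth j < j)%N.
Proof.
have bound i : (thin_depth i <= i.-1)%N.
  elim: i => [//|[|i] ih]; first by rewrite thin_depthS.
  by rewrite thin_depthS; move: ih => /=; case: (chosen _); lia.
by case: j (bound j) => [|j] //=; rewrite ltnS.
Qed.

Lemma thin_depth_unchosen j e : (forall i, (i < e)%N -> ~~ chosen (j + i)) ->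
  thin_depth (j + e) = thin_depth j.
Proof.
elim: e => [|e ih] noc; first by rewrite addn0.
rewrite addnS thin_depthS (negPf (noc e (ltnSn e))) addn0 ih// => i ie.
by apply: noc; rewrite ltnW.
Qed.

Lemma thin_depth_inj i j :
  chosen i -> chosen j -> thin_depth i = thin_depth j -> i = j.
Proof.
have lt u v : (u < v)%N -> chosen u -> (thin_depth u < thin_depth v)%N.
  move=> uv cu; have := depth_le thin_depth_step uv; rewrite thin_depth_chosen//.
move=> ci cj ij; case: (ltngtP i j) => // [/lt/(_ ci)|/lt/(_ cj)]; by rewrite ij ltnn.
Qed.

Hypothesis r_bounds : forall j, 0 < r j < 2^-1.
Hypothesis alpha_ge0 : 0 <= alpha.

Lemma scale_pow_gt0 k : 0 < scale k `^ alpha.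
Proof. by rewrite powR_gt0// scale_gt0. Qed.

Lemma scale_pow_noninc k m : (k <= m)%N -> scale m `^ alpha <= scale k `^ alpha.
Proof.
by move=> km; apply: powR_le_base; rewrite ?scale_noninc// ltW// scale_gt0.
Qed.

Lemma thin_count_le k : 2 ^+ thin_depth k * scale k `^ alpha <= 2.
Proof.
elim: k => [|k ih]; first by rewrite expr0 mul1r scale0 powR1 ler1n.
have lk : 2 ^+ thin_depth k * scale k.+1 `^ alpha <=
    2 ^+ thin_depth k * scale k `^ alpha.
  by rewrite ler_wpM2l ?exprn_ge0// scale_pow_noninc.
rewrite thin_depthS; case: (boolP (chosen k)) => [/andP[_ ck]|_].
  rewrite addn1 exprS -mulrA -[leRHS]mulr1 ler_pM2l//.
  exact: le_trans lk ck.
by rewrite addn0; exact: le_trans ih.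
Qed.

(** The witness [i] is the last level before [k] that was not chosen, where the
    number of nodes was large enough, or 0; since then it doubled at each
    level. *)
Lemma thin_count_run k : exists2 i, (i <= k)%N &
  2 ^+ (k - i) <= 2 * (2 ^+ thin_depth k * scale i `^ alpha) :> R.
Proof.
elim: k => [|k [i ik ih]].
  by exists 0%N => //; rewrite !expr0 mul1r scale0 powR1 mulr1 ler1n.
rewrite thin_depthS; case: (boolP (chosen k)) => [_|].
  by exists i; rewrite ?leqW// subSn// addn1 !exprS -[2 * _ * _]mulrA ler_pM2l.
rewrite negb_and -leqNgt leqn0 -ltNge => not_chosen.
exists k => //; rewrite subSnn expr1 addn0.
case/orP: not_chosen => [/eqP->|]; last first.
  by move=> /ltW h; rewrite -[leLHS]mulr1 ler_pM2l.
by rewrite expr0 mul1r scale0 powR1 mulr1.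
Qed.

Lemma scale_ratio_pow k m :
  (scale k / scale m) `^ alpha = scale k `^ alpha / scale m `^ alpha.
Proof.
have lm := scale_gt0 r_bounds m; have lk := scale_gt0 r_bounds k.
have km0 : 0 <= scale k / scale m by rewrite divr_ge0// ltW.
have := powRM alpha km0 (ltW lm); rewrite divfK ?gt_eqF// => ->.
by rewrite mulfK// gt_eqF// scale_pow_gt0.
Qed.

(** Since the last level that was not chosen, [scale _ `^ (- alpha)] has not
    grown faster than powers of two, up to a constant; so the greedy choice
    has never lagged behind. *)
Lemma thin_count_ge (c : R) : 0 < c ->
  (forall k m, (k <= m)%N -> c * (scale k / scale m) `^ alpha <= 2 ^+ (m - k)) ->
  forall k, c / 2 <= 2 ^+ thin_depth k * scale k `^ alpha.
Proof.
move=> c0 growth k; have [i ik ki] := thin_count_run k.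
have := le_trans (growth i k ik) ki; rewrite scale_ratio_pow.
rewrite !mulrA ler_pdivrMr ?scale_pow_gt0// => h.
rewrite -(ler_pM2r (scale_pow_gt0 i)).
move: (2 ^+ thin_depth k) (scale i `^ alpha) (scale k `^ alpha) h {ki} => e u v.
lra.
Qed.

Lemma thin_growth (c : R) : 0 < c ->
  (forall k m, (k <= m)%N -> c * (scale k / scale m) `^ alpha <= 2 ^+ (m - k)) ->
  forall k m, (k <= m)%N ->
    c / 4 * (scale k / scale m) `^ alpha <= 2 ^+ (thin_depth m - thin_depth k).
Proof.
move=> c0 growth k m km; rewrite scale_ratio_pow mulrA ler_pdivrMr ?scale_pow_gt0//.
have e0 : 0 < 2 ^+ thin_depth k :> R by rewrite exprn_gt0.
rewrite -(ler_pM2l e0) [leRHS]mulrA -exprD subnKC ?(depth_le thin_depth_step)//.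
have {e0} hk : c / 4 * (2 ^+ thin_depth k * scale k `^ alpha) <= c / 4 * 2.
  by rewrite ler_wpM2l ?thin_count_le// divr_ge0// ltW.
have := thin_count_ge c0 growth m; move: hk.
move: (2 ^+ thin_depth k) (2 ^+ thin_depth m) (scale k `^ alpha) => e f u.
by move: (scale m `^ alpha) => v; lra.
Qed.

(** Without branching the number of nodes stays fixed while
    [scale j `^ (- alpha)] is multiplied by at least [2 `^ alpha] at each
    level, so a level is chosen within a bounded number of steps. *)
Lemma chosen_dense : 0 < alpha -> exists d, forall j, exists2 i,
  (j <= i <= j + d)%N & chosen i /\ thin_depth i = thin_depth j.
Proof.
move=> alpha_gt0.
have [d d_gt0 half] : exists2 d, (0 < d)%N & (2^-1 ^+ d) `^ alpha <= 2^-1 :> R.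
  have half_gt0 : 0 < 2^-1 `^ alpha^-1 :> R by rewrite powR_gt0.
  have := @cvg_expr R 2^-1; rewrite ger0_norm// invf_lt1 ?ltr1n// => /(_ isT).
  move=> /cvgrPdist_lt/(_ _ half_gt0)[d _ /(_ d.+1 (leqnSn d))].
  rewrite sub0r normrN ger0_norm ?exprn_ge0// => /ltW hd; exists d.+1 => //.
  apply: le_trans (powR_le_base alpha_ge0 _ hd) _; first by rewrite exprn_ge0.
  by rewrite -powRrM mulVf ?gt_eqF// powRr1.
have contract j : scale (j + d) <= 2^-1 ^+ d * scale j.
  elim: d {d_gt0 half} => [|d ih]; first by rewrite addn0 expr0 mul1r.
  rewrite addnS exprS; apply: le_trans (ltW (scaleS_lt r_bounds _)) _.
  by rewrite mulrC -mulrA ler_wpM2l.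
exists d => j.
have [i id ci] : exists2 i, (i <= d)%N & chosen (j + i).
  apply: contrapT => noc.
  have unchosen i : (i <= d)%N -> ~~ chosen (j + i).
    by move=> id; apply/negP => ci; apply: noc; exists i.
  have := unchosen d (leqnn d); rewrite /chosen addn_gt0 d_gt0 orbT/=.
  rewrite thin_depth_unchosen => [/negP|i id]; last exact/unchosen/ltnW.
  apply; apply: le_trans (_ : 2 ^+ thin_depth j * (2^-1 * scale j `^ alpha) <= _).
    rewrite ler_wpM2l ?exprn_ge0//.
    apply: le_trans (powR_le_base alpha_ge0 (ltW (scale_gt0 r_bounds _)) (contract j)) _.
    rewrite powRM ?exprn_ge0 ?(ltW (scale_gt0 _ _))//.
    by rewrite ler_wpM2r// ltW// scale_pow_gt0.
  by rewrite mulrCA mulrC ler_pdivrMr// mul1r thin_count_le.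
have ex_i : exists i, chosen (j + i) by exists i.
case: (ex_minnP ex_i) => i0 c0 min0; exists (j + i0)%N.
  by rewrite leq_addr leq_add2l (leq_trans (min0 _ ci)).
split=> //; apply: thin_depth_unchosen => i' i'0.
by apply/negP => /min0; rewrite leqNgt i'0.
Qed.

End Thin.

(** * The complementary set: a thin part followed by a fat part *)

Section ThinFat.
Variables (R : realType) (r : R^nat) (alpha : R).
Hypothesis r_bounds : forall j, 0 < r j < 2^-1.
Hypothesis alpha_ge0 : 0 <= alpha.
Local Notation scale := (scale r).
Local Notation a := (central_gap r).
Local Notation thin_depth := (thin_depth r alpha).
Local Notation chosen := (chosen r alpha).

(** The thin part only takes gaps of even rank, that is, left children in the
    binary tree of the Cantor set: a node of the fat part deprived of its gap
    has a right child that keeps its own. *)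
Definition thin (q : nat) : bool :=
  [&& chosen (level q), ~~ odd (rank q) & ((rank q)./2 < 2 ^ thin_depth (level q))%N].

(** The thin part has its keys between -1 and 0, the fat part between 0 and 1.
    In each part the key is the midpoint of the node that the gap splits. *)
Definition thin_fat_key (q : nat) : R :=
  if thin q then -1 + dyadic R (thin_depth (level q)).+1 (2 * (rank q)./2 + 1)
  else 0 + dyadic R (level q).+1 (2 * rank q + 1).

Local Notation key := thin_fat_key.
Local Notation E := (arranged a key).

Lemma thin_key q : thin q ->
  key q = -1 + dyadic R (thin_depth (level q)).+1 (2 * (rank q)./2 + 1).
Proof. by rewrite /key => ->. Qed.

Lemma fat_key q : ~~ thin q -> key q = 0 + dyadic R (level q).+1 (2 * rank q + 1).
Proof. by rewrite /key => /negPf->. Qed.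

Lemma thin_key_bounds q : thin q -> -1 < key q < 0.
Proof.
move=> tq; rewrite thin_key//; case/and3P: tq => _ _ /(dyadic_odd_lt1 R).
by have := dyadic_odd_gt0 R (thin_depth (level q)) (rank q)./2; lra.
Qed.

Lemma fat_key_bounds q : ~~ thin q -> 0 < key q < 1.
Proof.
move=> tq; rewrite fat_key// add0r dyadic_odd_gt0.
exact/dyadic_odd_lt1/rank_lt.
Qed.

Lemma key_neq0 q : key q != 0.
Proof.
case: (boolP (thin q)) => [/thin_key_bounds|/fat_key_bounds] /andP[h1 h2].
  by rewrite lt_eqF.
by rewrite gt_eqF.
Qed.

Lemma thin_pos_inj q q' : thin q -> thin q' -> level q = level q' ->
  (rank q)./2 = (rank q')./2 -> q = q'.
Proof.
move=> /and3P[_ eq _] /and3P[_ eq' _] lq rq; apply: level_rank_inj => //.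
by rewrite -(even_halfK eq) rq even_halfK.
Qed.

Lemma key_inj : injective key.
Proof.
move=> q q' qq'.
case: (boolP (thin q)) => tq; case: (boolP (thin q')) => tq'.
- move: qq'; rewrite !thin_key// => /addrI/dyadic_odd_inj[lq rq].
  apply: thin_pos_inj => //; case/and3P: tq => cq _ _; case/and3P: tq' => cq' _ _.
  exact: thin_depth_inj lq.
- exfalso; have := thin_key_bounds tq; have := fat_key_bounds tq'; rewrite qq'; lra.
- exfalso; have := thin_key_bounds tq'; have := fat_key_bounds tq; rewrite qq'; lra.
- move: qq'; rewrite !fat_key// => /addrI/dyadic_odd_inj[lq rq].
  exact: level_rank_inj.
Qed.

Let a_gt0 := central_gap_gt0 r_bounds.
Let a_ge0 q : 0 <= a q. Proof. exact/ltW/a_gt0. Qed.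
Let a_cvg := cvg_central_gap r_bounds.

Lemma thin_branches q : thin q -> (thin_depth (level q) < thin_depth (level q).+1)%N.
Proof. by move=> /and3P[/thin_depth_chosen-> _ _]. Qed.

Lemma thin_nonpart q : ~~ thin q -> key q <= -1 \/ -1 + 1 <= key q.
Proof. by move=> /fat_key_bounds; right; lra. Qed.

Lemma fat_nonpart q : ~~ ~~ thin q -> key q <= 0 \/ 0 + 1 <= key q.
Proof. by rewrite negbK => /thin_key_bounds; left; lra. Qed.

Lemma id_step j : (j <= j.+1 <= j.+1)%N. Proof. by rewrite leqnSn leqnn. Qed.

Lemma thin_gap_index j s : chosen j -> (s < 2 ^ thin_depth j)%N ->
  [/\ level (gap_index j (2 * s)) = j, thin (gap_index j (2 * s)) &
      (rank (gap_index j (2 * s)))./2 = s].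
Proof.
move=> cj sj; have s2j : (2 * s < 2 ^ j)%N.
  apply: leq_trans (_ : 2 ^ (thin_depth j).+1 <= _)%N; first by rewrite expnS; lia.
  by rewrite leq_pexp2l// thin_depth_lt.
have [lE rE] := gap_indexK s2j.
by rewrite /thin lE rE cj mul2n odd_double doubleK sj.
Qed.

Lemma arranged_bounds x : E x -> upto a key (-1) <= x <= below a key (0 + 1).
Proof.
rewrite /arranged add0r => -[/=]; rewrite in_itv/= => xL _.
suff [-> ->] : upto a key (-1) = 0 /\ below a key 1 = limn (series a) by [].
split.
  rewrite -[RHS](subsum0 a_ge0 a_cvg); apply: eq_subsum => q; apply/negbTE.
  rewrite -ltNge; case: (boolP (thin q)) => [/thin_key_bounds|/fat_key_bounds]; lra.
rewrite -subsumT; apply: eq_subsum => q.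
by case: (boolP (thin q)) => [/thin_key_bounds|/fat_key_bounds]; lra.
Qed.

Lemma upto_below0 : upto a key 0 = below a key (-1 + 1).
Proof. by rewrite addNr upto_nokey//; exact: key_neq0. Qed.

Lemma arranged_split x : E x ->
  upto a key (-1) <= x <= below a key (-1 + 1) \/
  upto a key 0 <= x <= below a key (0 + 1).
Proof.
move=> /arranged_bounds/andP[x1 x2].
rewrite upto_below0; case: (leP x (below a key (-1 + 1))) => h.
  by left; rewrite x1.
by right; rewrite (ltW h).
Qed.

Lemma thin_part_gt0 : upto a key (-1) < below a key (-1 + 1).
Proof.
have c1 : chosen 1.
  rewrite /chosen /= add0n expr0 mul1r.
  by apply: powR_le1 => //; [exact/ltW/scale_gt0|exact: scale_le1].
have [lq tq _] := thin_gap_index c1 (expn_gt0 2 _ : 0 < _)%N.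
rewrite -subr_gt0 upto_sub_below//; last by lra.
apply: lt_le_trans (a_gt0 (gap_index 1 (2 * 0))) _.
apply: (le_mem_subsum a_ge0 a_cvg (P := fun q => -1 < key q < -1 + 1)).
by rewrite addNr thin_key_bounds.
Qed.

(** ** Lower bounds *)

Variables (delta rmin : R).
Hypothesis delta_gt0 : 0 < delta.
Hypothesis gap_ratio : forall j, delta <= 1 - 2 * r j.
Hypothesis rmin_gt0 : 0 < rmin.
Hypothesis rmin_le1 : rmin <= 1.
Hypothesis scale_step : forall k, rmin * scale k <= scale k.+1.

Lemma gap_ge q : delta * scale (level q) <= a q.
Proof. by rewrite central_gapE mulrC ler_pM2l// scale_gt0. Qed.

Lemma scale_add_ge k e : rmin ^+ e * scale k <= scale (k + e).
Proof.
elim: e => [|e ih]; first by rewrite addn0 expr0 mul1r.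
rewrite addnS exprS -mulrA; apply: le_trans (scale_step _).
by rewrite ler_pM2l.
Qed.

Lemma gap_ge_scale k d q : (k <= level q <= k + d)%N ->
  delta * rmin ^+ d * scale k <= a q.
Proof.
move=> /andP[_ qd]; apply: le_trans (gap_ge q); rewrite -mulrA ler_pM2l//.
exact: le_trans (scale_add_ge _ _) (scale_noninc r_bounds qd).
Qed.

(** If the gap that splits the node went to the thin part, the gap that splits
    its right child, of odd rank, did not. *)
Lemma fat_rich k p : (p < 2 ^ k)%N ->
  exists2 q, delta * rmin ^+ 1 * scale k <= a q &
    node_start 0 id k p < key q < node_start 0 id k p.+1.
Proof.
move=> pk; have k0 := expn_gt0 2 k; have [lq rq] := gap_indexK pk.
case: (boolP (thin (gap_index k p))) => [tq|tq]; last first.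
  exists (gap_index k p); first by apply: gap_ge_scale; rewrite lq leqnn leq_addr.
  rewrite fat_key// /node_start !ltrD2l lq rq !dyadic_lt !expnS.
  by apply/andP; lia.
have pS : (2 * p + 1 < 2 ^ k.+1)%N by rewrite expnS; lia.
have [lq' rq'] := gap_indexK pS.
exists (gap_index k.+1 (2 * p + 1)).
  by apply: gap_ge_scale; rewrite lq' leqnSn addn1 leqnn.
rewrite fat_key; last by rewrite /thin rq' mul2n addn1 /= odd_double andbF.
rewrite /node_start !ltrD2l lq' rq' !dyadic_lt !expnS.
by apply/andP; lia.
Qed.

Lemma thin_rich d : 
  (forall j, exists2 i, (j <= i <= j + d)%N &
     chosen i /\ thin_depth i = thin_depth j) ->
  forall k p, (p < 2 ^ thin_depth k)%N ->
  exists2 q, delta * rmin ^+ d * scale k <= a q &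
    node_start (-1) thin_depth k p < key q < node_start (-1) thin_depth k p.+1.
Proof.
move=> dense k p pk; have [i ki [ci ik]] := dense k.
have pi : (p < 2 ^ thin_depth i)%N by rewrite ik.
have [lq tq rq] := thin_gap_index ci pi.
exists (gap_index i (2 * p)); first by apply: gap_ge_scale; rewrite lq.
rewrite thin_key// /node_start !ltrD2l lq rq ik !dyadic_lt !expnS.
have t0 := expn_gt0 2 (thin_depth k); apply/andP; lia.
Qed.

Variable (c : R).
Hypothesis c_gt0 : 0 < c.
Hypothesis growth : forall k m, (k <= m)%N ->
  c * (scale k / scale m) `^ alpha <= 2 ^+ (m - k).

(** In the thin part the descendants are counted by [thin_growth], in the fat
    part by [growth]; a ball around a point of either part only needs the
    points of that part. *)
Lemma arranged_scattered : 0 < alpha -> exists2 c' : R, 0 < c' &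
  forall x u s, E x -> 0 < u -> u < s -> s < 1 ->
    ((c' * (s / u) `^ alpha)%:E <= covering_number u (closed_ball x s `&` E))%E.
Proof.
move=> alpha_gt0; have [d dense] := chosen_dense r_bounds alpha_ge0 alpha_gt0.
have [cT cT0 boundT] := covering_part_ge r_bounds
  (thin_depth_step r alpha) thin_branches thin_pos_inj thin_key thin_nonpart
  (thin_rich dense) (mulr_gt0 delta_gt0 (exprn_gt0 d rmin_gt0))
  (divr_gt0 c_gt0 (ltr0n _ 4)) rmin_gt0 rmin_le1 alpha_ge0 scale_step
  (thin_growth r_bounds alpha_ge0 c_gt0 growth).
have [cF cF0 boundF] := covering_part_ge r_bounds
  id_step (fun q _ => leqnn _) (fun q q' _ _ => @level_rank_inj q q') fat_key
  fat_nonpart fat_rich (mulr_gt0 delta_gt0 (exprn_gt0 1 rmin_gt0))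
  c_gt0 rmin_gt0 rmin_le1 alpha_ge0 scale_step growth.
exists (Num.min cT cF) => [|x u s Ex u0 us s1]; first by rewrite lt_min cT0.
have [xT|xF] := arranged_split Ex.
  apply: le_trans (boundT x u s Ex xT u0 us s1).
  by rewrite lee_fin ler_wpM2r ?powR_ge0// ge_min lexx.
apply: le_trans (boundF x u s Ex xF u0 us s1).
by rewrite lee_fin ler_wpM2r ?powR_ge0// ge_min lexx orbT.
Qed.

Lemma le_dim_arranged : (alpha%:E <= lower_assouad_dim E)%E.
Proof.
apply: ereal_sup_ubound; exists alpha => //=.
have [c' c'0 bound] : exists2 c' : R, 0 < c' &
    forall x u s, E x -> 0 < u -> u < s -> s < 1 ->
      ((c' * (s / u) `^ alpha)%:E <= covering_number u (closed_ball x s `&` E))%E.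
  have [|alpha_le0] := ltP 0 alpha; first exact: arranged_scattered.
  have -> : alpha = 0 by apply/le_anti/andP; split.
  exists 1 => // x u s Ex u0 us s1; rewrite powRr0 mulr1.
  apply: (covering_number_ge_separated (N := 1) (y := fun=> x)) => // [i _|i j].
    split=> //; apply/closed_ballP; first exact: lt_trans us.
    by rewrite subrr normr0 ltW// (lt_trans u0).
  by move=> ij; exfalso; lia.
exists c', 1; split=> // u s u0 us s1.
by apply: le_ereal_inf_tmp => _ [x Ex <-]; exact: bound.
Qed.

(** ** Upper bound *)

(** A fixed ball around the left end of the thin part avoids the fat part, and
    the number of balls of radius [scale m] needed to cover it is at most
    [2 ^ thin_depth m <= 2 * scale m `^ (- alpha)]; letting [m] tend to
    infinity excludes every exponent [gamma > alpha]. *)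
Lemma dim_arranged_le : (lower_assouad_dim E <= alpha%:E)%E.
Proof.
apply: ge_ereal_sup => _ [gamma [c' [rho [c'0 rho0 bound]]] <-].
rewrite lee_fin leNgt; apply/negP => alpha_gamma.
set x0 := upto a key (-1); have Ex0 : E x0 by exact: upto_arranged.
pose t := below a key (-1 + 1) - x0; have t0 : 0 < t by rewrite subr_gt0 thin_part_gt0.
pose s := Num.min rho t / 2.
have min0 : 0 < Num.min rho t by rewrite lt_min rho0.
have s0 : 0 < s by rewrite divr_gt0.
have s_min : s < Num.min rho t by rewrite ltr_pdivrMr// ltr_pMr// ltr1n.
have s_rho : s < rho by rewrite (lt_le_trans s_min)// ge_min lexx.
have s_t : s <= t by rewrite (le_trans (ltW s_min))// ge_min lexx orbT.
have ga : 0 < gamma - alpha by rewrite subr_gt0.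
(* Below the scale [e] the bound for [gamma] contradicts the one for [alpha]. *)
pose e := Num.min (s / 2) ((c' * s `^ gamma / 4) `^ (gamma - alpha)^-1).
have e0 : 0 < e by rewrite lt_min divr_gt0//= powR_gt0// divr_gt0// mulr_gt0// powR_gt0.
have [m lm] := scale_small r_bounds e0.
have lm0 := scale_gt0 r_bounds m.
have lms : scale m < s.
  apply: (le_lt_trans lm); apply: (@le_lt_trans _ _ (s / 2)).
    by rewrite ge_min lexx.
  by rewrite ltr_pdivrMr// ltr_pMr// ltr1n.
have covE : (covering_number (scale m) (closed_ball x0 s `&` E)
    <= (2 ^+ thin_depth m)%:E)%E.
  apply: (covering_part r_bounds (thin_depth_step r alpha) thin_branches
    thin_pos_inj thin_key thin_nonpart).
  move=> x [/(closed_ballP _ _ s0) xs Ex]; split=> //.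
  have /andP[x1 _] := arranged_bounds Ex; rewrite x1/=.
  by move: xs; rewrite ler_norml; have := s_t; rewrite /t; lra.
have := le_trans (le_trans (bound _ _ lm0 lms s_rho)
  (ereal_inf_lbound (ex_intro2 _ _ x0 Ex0 erefl))) covE.
rewrite lee_fin => cov.
have count : 2 ^+ thin_depth m * scale m `^ alpha <= 2 by exact: thin_count_le.
have small : scale m `^ (gamma - alpha) <= c' * s `^ gamma / 4.
  have root : scale m <= (c' * s `^ gamma / 4) `^ (gamma - alpha)^-1.
    by rewrite (le_trans lm)// ge_min lexx orbT.
  apply: le_trans (powR_le_base (ltW ga) (ltW lm0) root) _.
  rewrite -powRrM mulVf ?gt_eqF// powRr1//.
  by rewrite divr_ge0// mulr_ge0 ?powR_ge0// ltW.
have sE : (s / scale m) `^ gamma * scale m `^ gamma = s `^ gamma.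
  by rewrite -powRM ?divfK ?gt_eqF// ltW// divr_gt0.
have large : c' * s `^ gamma <= 2 * scale m `^ (gamma - alpha).
  rewrite -sE mulrA.
  apply: le_trans (ler_wpM2r (powR_ge0 _ _) cov) _.
  have -> : scale m `^ gamma = scale m `^ alpha * scale m `^ (gamma - alpha).
    by rewrite -powRD ?subrKC// [scale m == 0]gt_eqF ?implybT.
  by rewrite mulrA; apply: ler_wpM2r; rewrite ?powR_ge0.
have pos : 0 < c' * s `^ gamma by rewrite mulr_gt0// powR_gt0.
move: {cov count} small large pos.
by move: (c' * s `^ gamma) (scale m `^ (gamma - alpha)) => A B; lra.
Qed.

End ThinFat.

Theorem theorem14 (R : realType) (r : R^nat)
  (r_bounds : forall j, 0 < r j < 2^-1)
  (sup_r : sup (range r) < 2^-1)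
  (alpha : R) (alpha_ge0 : 0 <= alpha)
  (alpha_lt : (alpha%:E < lower_assouad_dim (central_cantor r))%E) :
  exists E : set R,
    complementary_set (central_gap r) E /\ lower_assouad_dim E = alpha%:E.
Proof.
have [_ [beta cantor_beta <-]] := ereal_sup_gt alpha_lt.
rewrite lte_fin => alpha_beta.
have beta_gt0 : 0 < beta := le_lt_trans alpha_ge0 alpha_beta.
have [c c_gt0 growth] := central_cantor_growth r_bounds (ltW beta_gt0) cantor_beta.
have ratio_gt0 k m : 0 < scale r k / scale r m by rewrite divr_gt0 ?scale_gt0.
have growth_alpha k m : (k <= m)%N ->
    c * (scale r k / scale r m) `^ alpha <= 2 ^+ (m - k).
  move=> km; apply: le_trans (growth k m km); rewrite ler_pM2l//.
  apply: ler_powR (ltW alpha_beta).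
  by rewrite ler_pdivlMr ?scale_gt0// mul1r scale_noninc.
(* Two consecutive scales in [growth] bound the ratios away from 0. *)
pose rmin := Num.min 1 ((2 / c) `^ beta^-1)^-1.
have root_gt0 : 0 < (2 / c) `^ beta^-1 by rewrite powR_gt0// divr_gt0.
have rmin_gt0 : 0 < rmin by rewrite lt_min ltr01 invr_gt0.
have rmin_le1 : rmin <= 1 by rewrite ge_min lexx.
have scale_step k : rmin * scale r k <= scale r k.+1.
  have pow_ratio : (scale r k / scale r k.+1) `^ beta <= 2 / c.
    by rewrite ler_pdivlMr// mulrC; have := growth k k.+1 (leqnSn k); rewrite subSnn.
  have ratio : scale r k / scale r k.+1 <= (2 / c) `^ beta^-1.
    have := powR_le_base (_ : 0 <= beta^-1) (powR_ge0 _ _) pow_ratio.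
    rewrite -powRrM divff ?gt_eqF// powRr1 ?(ltW (ratio_gt0 _ _))//.
    by apply; rewrite invr_ge0 ltW.
  rewrite ler_pdivrMr ?scale_gt0// in ratio.
  apply: le_trans (_ : ((2 / c) `^ beta^-1)^-1 * scale r k <= _).
    by rewrite ler_wpM2r ?(ltW (scale_gt0 _ _))// ge_min lexx orbT.
  by rewrite mulrC ler_pdivrMr// mulrC.
have gap_ratio j : 1 - 2 * sup (range r) <= 1 - 2 * r j.
  rewrite lerD2l lerN2 ler_pM2l//; apply: ub_le_sup; last by exists j.
  by exists 2^-1 => _ [i _ <-]; apply/ltW; case/andP: (r_bounds i).
have delta_gt0 : 0 < 1 - 2 * sup (range r) by lra.
exists (arranged (central_gap r) (thin_fat_key r alpha)); split.
  apply: arranged_complementary; [exact: central_gap_gt0|exact: cvg_central_gap|].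
  exact: key_inj.
apply/le_anti/andP; split; first exact: dim_arranged_le.
exact: (le_dim_arranged r_bounds alpha_ge0 delta_gt0 gap_ratio rmin_gt0 rmin_le1
  scale_step c_gt0 growth_alpha).
Qed.
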